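(* Let $F\hookrightarrow E\xrightarrow{p}B$ be a fibre bundle with structure group $G$, where $E$ is a completely normal, path-connected space and $B$ is a paracompact space. Let $\{U_1,\dots,U_m\}$ be an open cover of $B$ such that, for each $i\in\{1,\dots,m\}$, there exists a closed subset $R_i$ of $B$ containing $U_i$ such that $U_i$ is categorical in $R_i$ and $R_i$ is categorical in $B$. If there exist trivializations $\phi_i\colon p^{-1}(R_i)\to R_i\times F$ of $p$ over $R_i$ such that the restrictions of the $\phi_i$ over the closures $\overline{U_i}$ form a $G$-atlas of $p$, then $$\mathrm{cat}(E)\le m+\mathrm{cat}_G^{\#}(F)-1 .$$
   Context: A subset $A$ of a space $X$ is categorical in $X$ if the inclusion $A\hookrightarrow X$ is null-homotopic. $\mathrm{cat}(X)$ is the smallest $n$ such that $X$ has an open cover by $n$ sets categorical in $X$. The structure group $G$ acts on $F$; for a $G$-space $F$, $\mathrm{cat}_G^{\#}(F)$ is the smallest $n$ such that $F$ has an open cover by $n$ $G$-invariant sets that are categorical in $F$ (null-homotopies need not be equivariant). Both are $\infty$ if no such $n$ exists. A trivialization over a (not necessarily open) subset $R\subseteq B$ is a homeomorphism $p^{-1}(R)\to R\times F$ over $R$. The restrictions form a $G$-atlas means: for all $i,i'$ there is a continuous map $\tau_{i'i}\colon\overline{U_i}\cap\overline{U_{i'}}\to G$ with $\phi_{i'}\circ\phi_i^{-1}(x,y)=(x,\tau_{i'i}(x)y)$ for $x\in\overline{U_i}\cap\overline{U_{i'}}$, $y\in F$. *)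

(* Defs.v *)
From HB Require Import structures.
From mathcomp Require Import all_boot all_order all_algebra.
From mathcomp Require Import all_classical all_reals all_analysis.

Set Implicit Arguments.
Unset Strict Implicit.
Unset Printing Implicit Defensive.

Import Order.TTheory GRing.Theory Num.Theory.
Import numFieldNormedType.Exports.

Local Open Scope classical_set_scope.
Local Open Scope ring_scope.

HB.mixin Record TopologicalGroup_hasContinuousOps G
    & Topological G & Group G := {
  mulg_continuous : continuous (fun xy : G * G => (xy.1 * xy.2)%g);
  invg_continuous : continuous (fun x : G => (x^-1)%g)
}.

#[short(type="topologicalGroupType")]
HB.structure Definition TopologicalGroup :=
  {G of Topological G & Group G & TopologicalGroup_hasContinuousOps G}.

Definition continuous_action (G : topologicalGroupType) (F : topologicalType)
    (act : G -> F -> F) : Prop :=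
  [/\ forall y, act 1%g y = y,
      forall g h y, act (g * h)%g y = act g (act h y)
    & continuous (fun gy : G * F => act gy.1 gy.2)].

Definition invariant (G : topologicalGroupType) (F : topologicalType)
    (act : G -> F -> F) (A : set F) : Prop :=
  forall g, act g @` A `<=` A.

(* The T1 axiom is not part of complete normality here. *)
Definition completely_normal (X : topologicalType) : Prop :=
  forall A B : set X, separated A B ->
    exists U V, [/\ open U, open V, A `<=` U, B `<=` V & U `&` V = set0].

(* Hausdorffness is not part of paracompactness here. *)
Definition paracompact (X : topologicalType) : Prop :=
  forall C : set (set X), C `<=` open -> \bigcup_(A in C) A = setT ->
    exists D : set (set X),
      [/\ D `<=` open,
          \bigcup_(A in D) A = setT,
          forall A, D A -> exists2 A', C A' & A `<=` A'
        & forall x : X, exists2 N, nbhs x N &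
            finite_set [set A | D A /\ A `&` N !=set0]].

(* The unit interval lives in an arbitrary model K of the real numbers;
   maps out of [0, 1] are total functions on K, restricted to [0, 1]. *)
(* The empty space is not path-connected. *)
Definition path_connected (K : realType) (X : topologicalType) : Prop :=
  [set: X] !=set0 /\
  forall x y : X, exists f : K -> X,
    [/\ {within `[0, 1], continuous f}, f 0 = x & f 1 = y].

Definition homotopic (K : realType) (X Y : topologicalType) (f g : X -> Y)
    : Prop :=
  exists H : X * K -> Y,
    [/\ {within [set: X] `*` `[0, 1], continuous H},
        forall x, H (x, 0) = f x
      & forall x, H (x, 1) = g x].

Definition null_homotopic (K : realType) (X Y : topologicalType) (f : X -> Y)
    : Prop :=
  exists y : Y, homotopic K f (cst y).

Definition categorical (K : realType) (X : topologicalType) (A : set X)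
    : Prop :=
  null_homotopic K (set_val : A -> X).

(* The least element of P, and +oo if P is empty. *)
Definition least_nat (K : realType) (P : set nat) : \bar K :=
  ereal_inf [set n%:R%:E | n in P].

Lemma least_nat0 (K : realType) : least_nat K set0 = +oo%E.
Proof. by rewrite /least_nat image_set0 ereal_inf0. Qed.

Lemma least_natP (K : realType) (P : set nat) (n : nat) :
  P n -> (forall k, P k -> (n <= k)%N) -> least_nat K P = n%:R%:E.
Proof.
move=> Pn minP; apply/eqP; rewrite eq_le; apply/andP; split.
  by apply: ereal_inf_lbound; exists n.
by apply: le_ereal_inf_tmp => _ [k Pk <-]; rewrite lee_fin ler_nat minP.
Qed.

Definition ls_cat (K : realType) (X : topologicalType) : \bar K :=
  least_nat K [set n | exists U : 'I_n -> set X,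
    [/\ \bigcup_i U i = setT,
        forall i, open (U i)
      & forall i, categorical K (U i)]].

Definition equivariant_cat (K : realType) (G : topologicalGroupType)
    (F : topologicalType) (act : G -> F -> F) : \bar K :=
  least_nat K [set n | exists U : 'I_n -> set F,
    [/\ \bigcup_i U i = setT,
        forall i, open (U i),
        forall i, invariant act (U i)
      & forall i, categorical K (U i)]].

(* Maps are total functions that only matter on A and C, so restricting
   a homeomorphism to smaller subsets keeps the same f and g. *)
Definition homeomorphism_between (X Y : topologicalType) (A : set X)
    (C : set Y) (f : X -> Y) (g : Y -> X) : Prop :=
  [/\ {within A, continuous f} /\ {within C, continuous g},
      f @` A `<=` C, g @` C `<=` A,
      {in A, cancel f g} & {in C, cancel g f}].

(* phiV plays the role of the inverse of phi. *)
Definition trivialization (E B F : topologicalType) (p : E -> B) (S : set B)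
    (phi : E -> B * F) (phiV : B * F -> E) : Prop :=
  homeomorphism_between (p @^-1` S) (S `*` [set: F]) phi phiV /\
  forall e, S (p e) -> (phi e).1 = p e.

Definition G_atlas (E B F : topologicalType) (G : topologicalGroupType)
    (act : G -> F -> F) (I : Type) (S : I -> set B)
    (phi : I -> E -> B * F) (phiV : I -> B * F -> E) : Prop :=
  forall i i', exists2 tau : B -> G,
    {within S i `&` S i', continuous tau} &
    forall x y, (S i `&` S i') x -> phi i' (phiV i (x, y)) = (x, act (tau x) y).

Definition fibre_bundle (E B F : topologicalType) (G : topologicalGroupType)
    (act : G -> F -> F) (p : E -> B) : Prop :=
  [/\ continuous_action act, continuous p &
      exists (I : Type) (S : I -> set B)
             (phi : I -> E -> B * F) (phiV : I -> B * F -> E),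
        [/\ \bigcup_i S i = setT,
            forall i, open (S i),
            forall i, trivialization p (S i) (phi i) (phiV i)
          & G_atlas act S phi phiV]].

(* Main.v *)
Require Import Defs.
From mathcomp Require Import all_boot all_order all_algebra.
From mathcomp Require Import all_classical all_reals all_analysis.
From mathcomp Require Import lra zify.

Set Implicit Arguments.
Unset Strict Implicit.
Unset Printing Implicit Defensive.

Import Order.TTheory GRing.Theory Num.Theory.
Import numFieldNormedType.Exports.

Local Open Scope classical_set_scope.
Local Open Scope ring_scope.

(** Let [V_0, ..., V_(n-1)] be an open cover of [F] by invariant sets that are
categorical in [F].  Over [U_i], the trivialization [phi_i] turns [U_i * V_j]
into an open box [W i j] of [E].  The box contracts in [E]: contract [U_i] in
[R_i] and [V_j] in [F] at the same time, and carry the homotopy to [E] by the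
inverse of [phi_i], which is defined on all of [R_i * F]
([categorical_trivialization_box]).

There are [m * n] boxes, and only [m + n - 1] sets are wanted, so boxes have to
be merged.  Sort the points of [E] by the least [i] such that [U_i] contains
their projection, then by the least [j] such that they lie in [W i j].  Since
the [V_j] are invariant, whether a point lies in the [j]-th box does not depend
on the trivialization used to test it ([G_atlas_invariant]); as a consequence,
two distinct cells on the same antidiagonal [i + j = k] are separated: when one
index increases the other decreases, and one of the two minimality conditions
provides an open neighbourhood of either cell that misses the other.  Complete
normality then gives pairwise disjoint open neighbourhoods of the cells of an
antidiagonal, which can be shrunk to lie in the boxes
([completely_normal_finite_family]).  A disjoint union of open categorical sets
is categorical in a path-connected space, as all the contractions can be ended
at the same point ([categorical_bigcup_disjoint]).  So each of the [m + n - 1]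
antidiagonals yields one open categorical set ([ls_cat_le_diagonals]). *)

(** * Continuity relative to a subset *)

Lemma within_continuousP (X Y : topologicalType) (A : set X) (f : X -> Y) :
  {within A, continuous f} <->
  forall x V, A x -> nbhs (f x) V -> \forall x' \near x, A x' -> V (f x').
Proof.
split=> [/subspace_continuousP cf x V Ax fV|cf]; first exact: (cf x Ax V fV).
by apply/subspace_continuousP => x Ax V fV; exact: cf.
Qed.

Lemma within_comp (X Y Z : topologicalType) (A : set X) (B : set Y)
    (f : X -> Y) (g : Y -> Z) :
  (forall x, A x -> B (f x)) ->
  {within A, continuous f} -> {within B, continuous g} ->
  {within A, continuous (g \o f)}.
Proof.
move=> AB /within_continuousP cf /within_continuousP cg.
apply/within_continuousP => x V Ax gV.
apply: filterS (cf x _ Ax (cg _ _ (AB _ Ax) gV)) => x' fx' Ax'.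
by apply: fx' => //; exact: AB.
Qed.

Lemma within_pair (X Y Z : topologicalType) (A : set X)
    (f : X -> Y) (g : X -> Z) :
  {within A, continuous f} -> {within A, continuous g} ->
  {within A, continuous (fun x => (f x, g x))}.
Proof.
move=> /within_continuousP cf /within_continuousP cg.
apply/within_continuousP => x W Ax [[P Q] [/= fP gQ] PQW].
near=> x' => Ax'; apply: PQW; split => /=.
  by move: Ax'; near: x'; exact: cf.
by move: Ax'; near: x'; exact: cg.
Unshelve. all: by end_near. Qed.

Lemma fst_continuous (X Y : topologicalType) : continuous (@fst X Y).
Proof. by move=> [x y]; exact: cvg_fst. Qed.

Lemma snd_continuous (X Y : topologicalType) : continuous (@snd X Y).
Proof. by move=> [x y]; exact: cvg_snd. Qed.

(** * Homotopies and categorical sets *)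

Section homotopy.
Context (K : realType).

Lemma homotopic_precomp (X Y Z : topologicalType) (h : Z -> X) (f g : X -> Y) :
  continuous h -> homotopic K f g -> homotopic K (f \o h) (g \o h).
Proof.
move=> ch [H [cH H0 H1]]; exists (H \o (fun zt => (h zt.1, zt.2))).
split=> [|z|z] /=; [|by rewrite H0|by rewrite H1].
apply: within_comp cH; first by move=> [z t] [].
apply: within_pair; apply: continuous_subspaceT => zt.
  by apply: continuous_comp; [exact: fst_continuous|exact: ch].
exact: snd_continuous.
Qed.

Lemma homotopic_postcomp (X Y Z : topologicalType) (k : Y -> Z) (f g : X -> Y) :
  continuous k -> homotopic K f g -> homotopic K (k \o f) (k \o g).
Proof.
move=> ck [H [cH H0 H1]]; exists (k \o H).
split=> [|x|x] /=; [|by rewrite H0|by rewrite H1].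
by apply: within_continuous_comp cH => y _; exact: ck.
Qed.

Lemma homotopic_pair (X Y Z : topologicalType) (f f' : X -> Y) (g g' : X -> Z) :
  homotopic K f f' -> homotopic K g g' ->
  homotopic K (fun x => (f x, g x)) (fun x => (f' x, g' x)).
Proof.
move=> [H [cH H0 H1]] [L [cL L0 L1]]; exists (fun xt => (H xt, L xt)).
split=> [|x|x]; [exact: within_pair|by rewrite H0 L0|by rewrite H1 L1].
Qed.

Lemma homotopic_trans (X Y : topologicalType) (g f h : X -> Y) :
  homotopic K f g -> homotopic K g h -> homotopic K f h.
Proof.
move=> [H [cH H0 H1]] [L [cL L0 L1]].
pose HL (xt : X * K) :=
  if xt.2 <= 2^-1 then H (xt.1, 2 * xt.2) else L (xt.1, 2 * xt.2 - 1).
have affc (a b : K) : continuous (fun xt : X * K => (xt.1, a * xt.2 + b)).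
  move=> xt.
  apply: (@cvg_pair _ _ _ (nbhs xt) (nbhs xt.1) (nbhs (a * xt.2 + b))).
    exact: fst_continuous.
  apply: cvgD; last exact: cvg_cst.
  by apply: cvgM; [exact: cvg_cst|exact: (@snd_continuous X K)].
exists HL; split=> [|x|x]; last 2 first.
- by rewrite /HL /= ifT ?invr_ge0 ?ler0n// mulr0 H0.
- rewrite /HL /= ifF; last by apply/negbTE; rewrite -ltNge; lra.
  by rewrite (_ : 2 * 1 - 1 = 1 :> K) ?L1//; lra.
have closedS (a b : K) : closed ([set: X] `*` `[a, b] : set (X * K)).
  rewrite setTX; apply: preimage_closed; last exact: interval_closed.
  by move=> *; exact: snd_continuous.
apply: (@continuous_subspaceW (X * K)%type Y _
    (([set: X] `*` `[0, 2^-1]) `|` ([set: X] `*` `[2^-1, 1]))).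
  move=> [x t] [_ /=]; rewrite in_itv/= => /andP[t0 t1].
  have [t2|t2] := leP t 2^-1; [left|right]; split => //=; rewrite in_itv/=.
    by rewrite t0.
  by rewrite t1 (ltW t2).
apply: withinU_continuous => //.
- apply: (@subspace_eq_continuous _ _ _
    (H \o (fun xt : X * K => (xt.1, 2 * xt.2 + 0)))).
    move=> [x t]; rewrite inE => -[_ /=]; rewrite in_itv/= => /andP[_ t2].
    by rewrite /from_subspace /HL /= t2 addr0.
  apply: within_comp cH; last exact: continuous_subspaceT.
  by move=> [x t] [_ /=]; rewrite !in_itv/= => t01; split => //; lra.
- apply: (@subspace_eq_continuous _ _ _
    (L \o (fun xt : X * K => (xt.1, 2 * xt.2 + -1)))).
    move=> [x t]; rewrite inE => -[_ /=]; rewrite in_itv/= => /andP[t2 _].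
    rewrite /from_subspace /HL /=; case: ifP => // t2'.
    (* the two halves meet at t = 1/2, where both equal g *)
    have -> : t = 2^-1 by apply/eqP; rewrite eq_le t2 t2'.
    by rewrite divff ?pnatr_eq0// subrr H1 L0.
  apply: within_comp cL; last exact: continuous_subspaceT.
  by move=> [x t] [_ /=]; rewrite !in_itv/= => t01; split => //; lra.
Qed.

Lemma homotopic_cst (X Y : topologicalType) (y z : Y) :
  path_connected K Y -> homotopic K (cst y : X -> Y) (cst z).
Proof.
move=> [_ /(_ y z)[c [cc c0 c1]]]; exists (c \o snd); split=> [|x|x] //=.
apply: within_comp cc; first by move=> [x t] [].
by apply: continuous_subspaceT => xt; exact: snd_continuous.
Qed.

Lemma categorical_homotopic_cst (X : topologicalType) (A : set X) (y : X) :
  path_connected K X -> categorical K A ->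
  homotopic K (set_val : A -> X) (cst y).
Proof.
move=> pX [z Az]; apply: homotopic_trans Az _; exact: homotopic_cst.
Qed.

(** Homotopies defined on a subset as a type cannot be glued directly, since
each one has its own domain; total functions on the ambient space can be
compared and pasted. *)
Lemma homotopic_set_val_cstP (X : topologicalType) (A : set X) (y : X) :
  homotopic K (set_val : A -> X) (cst y) <->
  exists H : X * K -> X, [/\ {within A `*` `[0, 1], continuous H},
    forall x, A x -> H (x, 0) = x & forall x, A x -> H (x, 1) = y].
Proof.
split=> [[H [/within_continuousP cH H0 H1]]|[H [cH H0 H1]]]; last first.
  exists (H \o (fun at_ : A * K => (set_val at_.1, at_.2))); split.
  - apply: within_comp cH.
      by move=> [a t] [_ ?]; split => //=; exact: set_valP.
    apply: within_pair; apply: continuous_subspaceT => at_.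
      apply: continuous_comp; first exact: fst_continuous.
      exact: initial_continuous.
    exact: snd_continuous.
  - by move=> a /=; rewrite H0//; exact: set_valP.
  - by move=> a /=; rewrite H1//; exact: set_valP.
pose H' (xt : X * K) :=
  if pselect (A xt.1) is left Ax then H (SigSub (mem_set Ax), xt.2) else y.
have H'E x t (Ax : A x) : H' (x, t) = H (SigSub (mem_set Ax), t).
  rewrite /H' /=; case: pselect => // Ax'.
  by congr (H (_, _)); exact: val_inj.
exists H'; split=> [|x Ax|x Ax]; last 2 first.
- by rewrite H'E H0.
- by rewrite H'E H1.
apply/within_continuousP => -[x t] V [/= Ax t01]; rewrite H'E => HV.
have [] := cH _ _ _ HV; first by split.
move=> -[P Q] /= [[_ [[W oW <-] /= Wx WP]] tQ] PQV.
exists (W, Q) => /=; first by split => //; exact: open_nbhs_nbhs.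
move=> [x' t'] [/= Wx' Qt'] [/= Ax' t'01]; rewrite H'E.
apply: (PQV (_, _)); last by [].
by split => //=; apply: WP.
Qed.

Lemma categoricalW (X : topologicalType) (A B : set X) :
  A `<=` B -> categorical K B -> categorical K A.
Proof.
move=> AB [y /homotopic_set_val_cstP[H [cH H0 H1]]].
exists y; apply/homotopic_set_val_cstP; exists H.
split=> [|x /AB /H0|x /AB /H1] //.
by apply: continuous_subspaceW cH => -[x t] [/AB].
Qed.

(** Near a point of the union, openness and disjointness leave only one
contraction to consider; path-connectedness is what lets all of them end at a
common point. *)
Lemma categorical_bigcup_disjoint (X : topologicalType) (I : Type)
    (A : I -> set X) : path_connected K X ->
  (forall i, open (A i)) -> (forall i j, i <> j -> A i `&` A j = set0) ->
  (forall i, categorical K (A i)) -> categorical K (\bigcup_i A i).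
Proof.
move=> pX oA disjA catA; have [[y _] _] := pX.
have /choice[H HP] i := (homotopic_set_val_cstP (A i) y).1
  (categorical_homotopic_cst y pX (catA i)).
have eq_idx i j x : A i x -> A j x -> i = j.
  move=> Aix Ajx; apply: contrapT => /disjA.
  by rewrite -subset0 => /(_ x); apply.
pose L (xt : X * K) :=
  if pselect (exists i, A i xt.1) is left ex then H (projT1 (cid ex)) xt else y.
have LE i x t : A i x -> L (x, t) = H i (x, t).
  move=> Aix; rewrite /L /=; case: pselect => [ex|]; last by case; exists i.
  by case: cid => j /= Ajx; rewrite (eq_idx _ _ _ Aix Ajx).
exists y; apply/homotopic_set_val_cstP; exists L; split; last 2 first.
- by move=> x [i _ Aix]; rewrite (LE i)//; have [_ ->] := HP i.
- by move=> x [i _ Aix]; rewrite (LE i)//; have [_ _ ->] := HP i.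
apply/within_continuousP => -[x t] V [[i _ /= Aix] t01]; rewrite (LE i)// => HV.
have [/within_continuousP cH _ _] := HP i.
have nA : \forall xt \near (x, t), A i xt.1.
  by apply: fst_continuous; apply: open_nbhs_nbhs; split => //; exact: oA.
have := cH _ _ (conj Aix t01 : (A i `*` `[0, 1]) (x, t)) HV.
apply: filterS2 nA => -[x' t'] /= Aix' + [_ t'01].
by rewrite (LE i)//; apply.
Qed.

End homotopy.

(** * Merging boxes along antidiagonals *)

(** Separate the members two by two; the neighbourhood of a member is the
intersection of the open sets that separate it from each of the others, open
because [I] is finite. *)
Lemma completely_normal_finite_family (X : topologicalType) (I : finType)
    (C : I -> set X) : completely_normal X ->
  (forall i j, i <> j -> closure (C i) `&` C j = set0) ->
  exists O : I -> set X, [/\ forall i, open (O i), forall i, C i `<=` O i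
    & forall i j, i <> j -> O i `&` O j = set0].
Proof.
move=> nX sepC.
have /choice[S SP] (ij : I * I) : exists S : set X * set X, ij.1 <> ij.2 ->
    [/\ open S.1, open S.2, C ij.1 `<=` S.1, C ij.2 `<=` S.2
      & S.1 `&` S.2 = set0].
  have [/eqP ?|/eqP neq] := boolP (ij.1 == ij.2); first by exists (set0, set0).
  have [|P [Q [? ? ? ? ?]]] := nX (C ij.1) (C ij.2); last by exists (P, Q).
  by split; [|rewrite setIC]; apply: sepC => // /esym.
pose O i : set X :=
  [set x | forall j, i <> j -> (S (i, j)).1 x /\ (S (j, i)).2 x].
exists O; split=> [i|i x Cx j ij|i j ij].
- rewrite openE => x Ox; apply: filter_forall => j.
  apply: filter_imply => ij; have [S1x S2x] := Ox j ij.
  have [oS1 _ _ _ _] := SP (i, j) ij.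
  have [_ oS2 _ _ _] := SP (j, i) (nesym ij).
  by apply: filterI; apply: open_nbhs_nbhs.
- have [_ _ + _ _] := SP (i, j) ij; have [_ _ _ + _] := SP (j, i) (nesym ij).
  by move=> /(_ x Cx) ? /(_ x Cx).
- rewrite -subset0 => x [/(_ j ij)[S1x _] /(_ i (nesym ij))[_ S2x]].
  by have [_ _ _ _ <-] := SP (i, j) ij.
Qed.

(** This is the product inequality in a form that needs no product structure:
the hypothesis that [W i j `&` A i' `<=` W i' j] says that the [j]-th column is
the same subset whichever [A i] is used to look at it. *)
Lemma ls_cat_le_diagonals (K : realType) (X : topologicalType) (m n : nat)
    (A : 'I_m -> set X) (W : 'I_m -> 'I_n -> set X) :
  completely_normal X -> path_connected K X ->
  (forall i, open (A i)) -> \bigcup_i A i = setT ->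
  (forall i j, open (W i j)) -> (forall i, \bigcup_j W i j = A i) ->
  (forall i i' j, W i j `&` A i' `<=` W i' j) ->
  (forall i j, categorical K (W i j)) ->
  (ls_cat K X <= (m + n).-1%:R%:E)%E.
Proof.
move=> nX pX oA covA oW covW WA catW; apply: ereal_inf_lbound.
exists (m + n).-1 => //.
(* [C (i, j)]: points whose least row is [i] and whose least column is [j]. *)
pose C (q : 'I_m * 'I_n) : set X := [set x | [/\ W q.1 q.2 x,
  forall i : 'I_m, (i < q.1)%N -> ~ A i x
  & forall j : 'I_n, (j < q.2)%N -> ~ W q.1 j x]].
have WsubA i j : W i j `<=` A i by rewrite -covW => x Wx; exists j.
(* The cells off the antidiagonal [k] are emptied rather than removed, so that
   the same finite index type serves for every [k]. *)
pose diag (k : nat) (q : 'I_m * 'I_n) : set X :=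
  [set x | (q.1 + q.2 = k)%N /\ C q x].
have sepC k q q' : q <> q' -> closure (diag k q) `&` diag k q' = set0.
  move: q q' => [i j] [i' j'] /eqP qq'.
  rewrite -subset0 => x [clx [/= q'k [/= Wx minA minW]]].
  have qk : (i + j = k)%N.
    by have [y [[/= -> _] _]] := clx _ (@filterT _ (nbhs x) _).
  have [ii'|i'i|ii'] := ltngtP i i'; last first.
  - case/eqP: qq'; congr (_, _); apply: val_inj => //=.
    by apply: (@addnI i); rewrite qk -q'k ii'.
    (* [i' < i]: [A i'] is a neighbourhood of [x] missing the cell [(i, j)],
       by minimality of [i]. *)
  - have [|y [[_ [_ /(_ i' i'i) + _]]]] := clx (A i'); last by [].
    by apply: open_nbhs_nbhs; split; [exact: oA|exact: WsubA Wx].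
    (* [i < i'], so [j' < j]: a point of [W i' j'] in the cell [(i, j)] lies in
       [A i], hence in [W i j'], against minimality of [j]. *)
  - have j'j : (j' < j)%N by rewrite -(ltn_add2l i) qk -q'k ltn_add2r.
    have [|y [[_ [/= Wy _ /(_ j' j'j) +]] W'y]] := clx (W i' j').
      by apply: open_nbhs_nbhs; split; [exact: oW|].
    by apply; apply: (WA i'); split => //; exact: WsubA Wy.
have /choice[N NP] k := completely_normal_finite_family nX (@sepC k).
pose D k q := N k q `&` W q.1 q.2.
exists (fun k : 'I_(m + n).-1 => \bigcup_q D k q); split=> [|k|k].
- apply/seteqP; split=> // x _.
  have [i0 _ Ai0] : (\bigcup_i A i) x by rewrite covA.
  case: (arg_minnP (P := fun i => `[< A i x >]) (val : 'I_m -> nat)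
    (asboolT Ai0)) => i /asboolP Aix mini.
  have [j0 _ Wj0] : (\bigcup_j W i j) x by rewrite covW.
  case: (arg_minnP (P := fun j => `[< W i j x >]) (val : 'I_n -> nat)
    (asboolT Wj0)) => j /asboolP Wix minj.
  have ijlt : (i + j < (m + n).-1)%N.
    have := ltn_ord i; have := ltn_ord j; move: (nat_of_ord i) (nat_of_ord j).
    by move=> a b; lia.
  exists (Ordinal ijlt) => //; exists (i, j) => //; split => //=.
  have [_ + _] := NP (i + j)%N; apply; split => //; split => //= [i'|j'].
    by rewrite ltnNge => + /asboolP /mini; move=> /negP.
  by rewrite ltnNge => + /asboolP /minj; move=> /negP.
- apply: bigcup_open => q _; apply: openI; last exact: oW.
  by have [+ _ _] := NP k; apply.
- have [oN _ disjN] := NP k.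
  apply: categorical_bigcup_disjoint => // [q|q q' qq'|q].
  + by apply: openI; [exact: oN|exact: oW].
  + by rewrite /D setIACA disjN// set0I.
  + by apply: categoricalW (catW q.1 q.2); exact: subIsetr.
Qed.


(** * Boxes in a trivialization *)

Section trivialization.
Context (E B F : topologicalType) (p : E -> B) (R : set B).
Context (phi : E -> B * F) (phiV : B * F -> E).
Context (trivR : trivialization p R phi phiV).

Lemma trivialization_fst e : R (p e) -> (phi e).1 = p e.
Proof. by case: trivR => _; apply. Qed.

Lemma trivialization_cancel e : R (p e) -> phiV (p e, (phi e).2) = e.
Proof.
move=> Re; rewrite -(trivialization_fst Re) -surjective_pairing.
by have [[_ _ _ + _] _] := trivR; apply; rewrite inE.
Qed.

Lemma open_trivialization_box (U : set B) (V : set F) : continuous p ->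
  open U -> U `<=` R -> open V ->
  open [set e | U (p e) /\ V (phi e).2].
Proof.
move=> cp oU UR oV; rewrite openE => e [Ue Ve].
have [[[/within_continuousP cphi _] _ _ _ _] _] := trivR.
have nU : \forall e' \near e, U (p e').
  by apply: cp; apply: open_nbhs_nbhs.
have nV : nbhs (phi e) [set y | V y.2].
  by apply: snd_continuous; apply: open_nbhs_nbhs.
apply: filterS2 nU (cphi e _ (UR _ Ue) nV) => e' Ue' Ve'; split => //.
exact: Ve' (UR _ Ue').
Qed.

(** The inclusion of the box factors as [phiV] after the two projections, one
into [R] through [U] and one into [F] through [V]; each projection is
null-homotopic, hence so is the composite. *)
Lemma categorical_trivialization_box (K : realType) (U : set B) (V : set F) :
  continuous p -> U `<=` R -> categorical K (set_val @^-1` U : set R) ->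
  categorical K V -> categorical K [set e | U (p e) /\ V (phi e).2].
Proof.
move=> cp UR [r hr] [y hy]; set W := (X in categorical K X).
have WU (w : W) : U (p (set_val w)) by have [] := set_valP w.
have WV (w : W) : V (phi (set_val w)).2 by have [] := set_valP w.
have [[[cphi cphiV] _ _ _ _] _] := trivR.
pose b (w : W) : R := SigSub (mem_set (UR _ (WU w))).
pose u (w : W) : (set_val @^-1` U : set R) :=
  @SigSub _ _ _ (b w) (mem_set (WU w)).
pose v (w : W) : V := SigSub (mem_set (WV w)).
pose k (z : R * F) : E := phiV (set_val z.1, z.2).
have cu : continuous u.
  do 2 apply: continuous_comp_initial.
  move=> w; apply: (continuous_comp (@initial_continuous W E set_val w)).
  exact: cp.
have cv : continuous v.
  apply: continuous_comp_initial.
  have cW : continuous (phi \o (set_val : W -> E)).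
    apply/continuous_subspace_setT; apply: within_comp cphi.
      by move=> w _; exact: UR (WU w).
    by apply: continuous_subspaceT; exact: initial_continuous.
  by move=> w; apply: (continuous_comp (cW w)); exact: snd_continuous.
have ck : continuous k.
  apply/continuous_subspace_setT; apply: within_comp cphiV.
    by move=> z _; split => //; exact: set_valP.
  apply: within_pair; apply: continuous_subspaceT => z.
    apply: continuous_comp; first exact: fst_continuous.
    exact: initial_continuous.
  exact: snd_continuous.
exists (k (r, y)).
have -> : (set_val : W -> E) = k \o (fun w => (set_val (u w), set_val (v w))).
  by apply/funext => w; rewrite /k /= trivialization_cancel//; exact: UR (WU w).
apply: homotopic_postcomp ck _.
by apply: homotopic_pair;
  [exact: homotopic_precomp hr|exact: homotopic_precomp hy].
Qed.

End trivialization.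

(** Changing the trivialization moves the fibre coordinate by an element of
[G], which cannot leave an invariant set. *)
Lemma G_atlas_invariant (E B F : topologicalType) (G : topologicalGroupType)
    (act : G -> F -> F) (p : E -> B) (I : Type) (R S : I -> set B)
    (phi : I -> E -> B * F) (phiV : I -> B * F -> E) (V : set F) :
  (forall i, trivialization p (R i) (phi i) (phiV i)) ->
  G_atlas act S phi phiV -> Defs.invariant act V ->
  forall i i' e, R i (p e) -> S i (p e) -> S i' (p e) ->
  V (phi i e).2 -> V (phi i' e).2.
Proof.
move=> trivR atlas invV i i' e Re Sie Si'e Ve.
have [tau _ tauE] := atlas i i'.
have := tauE (p e) (phi i e).2 (conj Sie Si'e).
rewrite (trivialization_cancel (trivR i) Re) => -> /=.
by apply: (invV (tau (p e))); exists (phi i e).2.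
Qed.

Theorem corollary5p4 (K : realType) (E B F : topologicalType)
    (G : topologicalGroupType) (act : G -> F -> F) (p : E -> B)
    (bundle_p : fibre_bundle act p)
    (normalE : completely_normal E) (pathE : path_connected K E)
    (paracompactB : paracompact B)
    (m : nat) (U R : 'I_m -> set B)
    (openU : forall i, open (U i)) (coverU : \bigcup_i U i = setT)
    (closedR : forall i, closed (R i)) (UR : forall i, U i `<=` R i)
    (catU : forall i, categorical K (set_val @^-1` U i : set (R i)))
    (catR : forall i, categorical K (R i))
    (phi : 'I_m -> E -> B * F) (phiV : 'I_m -> B * F -> E)
    (trivR : forall i, trivialization p (R i) (phi i) (phiV i))
    (atlas : G_atlas act (fun i => closure (U i)) phi phiV) :
  (ls_cat K E <= m%:R%:E + equivariant_cat K act - 1)%E.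
Proof.
have [_ cp _] := bundle_p.
(* The bound is trivial when no cover of [F] of the required kind is finite. *)
rewrite /equivariant_cat; set P := [set n | _].
have [[n0 Pn0]|noP] := pselect (exists n, P n); last first.
  have -> : P = set0 by rewrite -subset0 => n Pn; apply: noP; exists n.
  by rewrite least_nat0 addey// addye// leey.
have exP : exists n, `[< P n >] by exists n0; apply/asboolP.
case: (ex_minnP exP) => n /asboolP Pn minP.
rewrite (least_natP K Pn); last by move=> k Pk; apply: minP; exact/asboolP.
have [V [coverV openV invV catV]] := Pn.
have [[e _] _] := pathE.
(* [m + n] is positive, so that its truncated predecessor is [m + n - 1]. *)
have m_gt0 : (0 < m)%N.
  have [i _ _] : (\bigcup_i U i) (p e) by rewrite coverU.
  exact: leq_ltn_trans (ltn_ord i).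
have n_gt0 : (0 < n)%N.
  have [j _ _] : (\bigcup_j V j) (phi (Ordinal m_gt0) e).2 by rewrite coverV.
  exact: leq_ltn_trans (ltn_ord j).
have -> : (m%:R%:E + n%:R%:E - 1 = (m + n).-1%:R%:E :> \bar K)%E.
  by rewrite -!EFinD -natrD -subn1 natrB// addn_gt0 m_gt0.
apply: (@ls_cat_le_diagonals K E m n (fun i => p @^-1` U i)
  (fun i j => [set e | U i (p e) /\ V j (phi i e).2])) => //.
- by move=> i; apply: open_comp => // x _; exact: cp.
- by rewrite -preimage_bigcup coverU.
- by move=> i j; apply: open_trivialization_box (trivR i) _ _ _ _ _ _.
- move=> i; apply/seteqP; split=> [x [j _ []]//|x Ux].
  have [j _ Vj] : (\bigcup_j V j) (phi i x).2 by rewrite coverV.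
  by exists j.
- move=> i i' j x [[Ux Vx] U'x]; split => //.
  apply: (G_atlas_invariant trivR atlas (invV j) (UR i _ Ux)) Vx;
  exact: subset_closure.
- move=> i j; exact: (categorical_trivialization_box (trivR i)).
Qed.
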